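(* Game logic $\mathsf{GL}$, the modal $\ast$-calculus $\mathsf{L}_\ast$ and the separable fragment $\mathsf{L}_s$ of the modal $\mu$-calculus are equiexpressive: for any two of these logics, every formula of the one has a formula of the other with the same truth set in every monotone neighbourhood structure.
   Context: A monotone neighbourhood structure is $\mathcal N=(W,V,E)$ with $V:\mathbb A\to\mathcal P(W)$ for propositional constants and monotone $E(a):\mathcal P(W)\to\mathcal P(W)$ for atomic games $a$; $w^d(A)=W\setminus w(W\setminus A)$. $\mathsf{GL}$: formulas $\varphi::=P\mid\neg\varphi\mid\varphi\lor\varphi\mid\langle\alpha\rangle\varphi$, games $\alpha::=a\mid?\varphi\mid\alpha\cup\alpha\mid\alpha;\alpha\mid\alpha^*\mid\alpha^d$; truth set: $[\![P]\!]=V(P)$, $\neg$ complement, $\lor$ union, $[\![\langle\alpha\rangle\varphi]\!]=[\![\alpha]\!]([\![\varphi]\!])$, $[\![a]\!]=E(a)$, $[\![?\varphi]\!](A)=[\![\varphi]\!]\cap A$, $\cup$ pointwise union, $;$ composition, $[\![\alpha^d]\!]=[\![\alpha]\!]^d$, $[\![\alpha^*]\!](A)=\mu B.(A\cup[\![\alpha]\!](B))$. Fixpoint logic with chop $\mathsf{FLC}$: $\varphi::=\mathrm{id}\mid P\mid\neg P\mid x\mid\varphi\lor\varphi\mid\varphi\land\varphi\mid\langle a\rangle\varphi\mid[a]\varphi\mid\mu x.\varphi\mid\nu x.\varphi\mid\varphi\circ\varphi$; each formula denotes (under a valuation $I$ of variables by monotone maps) a monotone map $\mathcal P(W)\to\mathcal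 P(W)$: $\mathrm{id}$ the identity, $P$ and $\neg P$ the constant maps $V(P)$ and $W\setminus V(P)$, $x\mapsto I(x)$, $\lor,\land$ pointwise, $[\![\langle a\rangle\varphi]\!]=E(a)\circ[\![\varphi]\!]$, $[\![[a]\varphi]\!]=E(a)^d\circ[\![\varphi]\!]$, $\mu,\nu$ least/greatest fixpoints of $u\mapsto[\![\varphi]\!]_{I[x\mapsto u]}$ in the pointwise order, $[\![\varphi\circ\psi]\!]=[\![\varphi]\!]\circ[\![\psi]\!]$. The truth set of a closed formula is $[\![\varphi]\!](\emptyset)$. $\mathsf{L}_\ast$ is the fragment of closed $\mathsf{FLC}$ formulas containing no fixpoints except of the form $\varphi^*:=\mu x.(\mathrm{id}\lor\varphi\circ x)$ with $x$ not occurring in $\varphi$. Modal $\mu$-calculus $\mathsf{L}_\mu$: closed formulas of $\varphi::=P\mid\neg P\mid x\mid\varphi\lor\varphi\mid\varphi\land\varphi\mid\langle a\rangle\varphi\mid[a]\varphi\mid\mu x.\varphi\mid\nu x.\varphi$ with the usual set semantics ($[\![\langle a\rangle\varphi]\!]=E(a)([\![\varphi]\!])$, $[\![[a]\varphi]\!]=E(a)^d([\![\varphi]\!])$, fixpoints on $\mathcal P(W)$). A formula is separable if it contains fixpoints only in the forms $\mu x.(\psi\lor\rho)$ and $\nu x.(\psi\land\rho)$ where $\rho$ does not mention $x$ and $\psi$ has no free variable other than $x$; $\mathsf{L}_s$ is the set of separable closed $\mathsf{L}_\mu$ formulas.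
   Formalization: L_* is taken to contain also the dual fixpoints νx.(id∧φ∘x) with x not occurring in φ (without them ¬⟨a*⟩P is not expressible), and at least one propositional constant is assumed to exist (otherwise GL and L_s have no formulas while L_* has id). *)

(* Defs.v *)
From mathcomp Require Import all_boot.
From mathcomp Require Import boolp classical_sets.

Set Implicit Arguments.
Unset Strict Implicit.
Unset Printing Implicit Defensive.

Local Open Scope classical_set_scope.

Section Fixpoints.
Variable W : Type.
Implicit Types (A B : set W) (f u : set W -> set W).

Definition monotone f : Prop := forall A B, A `<=` B -> f A `<=` f B.

Definition dual f : set W -> set W := fun A => ~` f (~` A).

Definition lfp f : set W := \bigcap_(B in [set B | f B `<=` B]) B.
Definition gfp f : set W := \bigcup_(B in [set B | B `<=` f B]) B.

(* The lattice of monotone maps with the pointwise order: only monotone maps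
   are candidates, since variables range over monotone maps. *)
Definition fle (u v : set W -> set W) : Prop := forall A, u A `<=` v A.

Definition mlfp (F : (set W -> set W) -> (set W -> set W)) : set W -> set W :=
  fun A => \bigcap_(u in [set u | monotone u /\ fle (F u) u]) u A.
Definition mgfp (F : (set W -> set W) -> (set W -> set W)) : set W -> set W :=
  fun A => \bigcup_(u in [set u | monotone u /\ fle u (F u)]) u A.

Lemma dual_monotone f : monotone f -> monotone (dual f).
Proof. by move=> mf A B AB; apply: subsetC; apply: mf; apply: subsetC. Qed.

Lemma lfp_least_fixpoint f : monotone f ->
  f (lfp f) = lfp f /\ forall B, f B = B -> lfp f `<=` B.
Proof.
move=> mf.
have pre : f (lfp f) `<=` lfp f.
  move=> w fw B fB; apply: (fB); apply: mf fw => v; exact.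
split; last by move=> B fB w; apply; rewrite /= fB.
by apply/seteqP; split=> // w; apply; apply: mf.
Qed.

Lemma gfp_greatest_fixpoint f : monotone f ->
  f (gfp f) = gfp f /\ forall B, f B = B -> B `<=` gfp f.
Proof.
move=> mf.
have post : gfp f `<=` f (gfp f).
  move=> w [B fB Bw]; apply: mf (fB _ Bw) => v Bv; by exists B.
split; last by move=> B fB w Bw; exists B; rewrite /= ?fB.
by apply/seteqP; split=> // w fw; exists (f (gfp f)) => //=; apply: mf.
Qed.

Definition monotone_op (F : (set W -> set W) -> (set W -> set W)) : Prop :=
  (forall u, monotone u -> monotone (F u)) /\
  (forall u v, monotone u -> monotone v -> fle u v -> fle (F u) (F v)).

Lemma mlfp_monotone F : monotone (mlfp F).
Proof. by move=> A B AB w Aw u [mu uF]; apply: (mu A) => //; apply: Aw. Qed.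

Lemma mgfp_monotone F : monotone (mgfp F).
Proof. by move=> A B AB w [u [mu uF] uw]; exists u => //; apply: (mu A). Qed.

Lemma mlfp_least_fixpoint F : monotone_op F ->
  [/\ monotone (mlfp F), F (mlfp F) = mlfp F &
      forall u, monotone u -> F u = u -> fle (mlfp F) u].
Proof.
move=> [mF1 mF2]; have mm := @mlfp_monotone F.
have pre : fle (F (mlfp F)) (mlfp F).
  move=> A w Fw u [mu uF]; apply: (uF).
  by apply: (mF2 _ _ mm mu _ A w Fw) => B v; apply.
split=> // [|u mu uF A w]; last by apply; split=> //; rewrite uF => B.
apply/funext=> A; apply/seteqP; split=> [|w]; first exact: pre.
by apply; split; [exact: mF1 | apply: mF2 => //; exact: mF1].
Qed.

Lemma mgfp_greatest_fixpoint F : monotone_op F ->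
  [/\ monotone (mgfp F), F (mgfp F) = mgfp F &
      forall u, monotone u -> F u = u -> fle u (mgfp F)].
Proof.
move=> [mF1 mF2]; have mm := @mgfp_monotone F.
have post : fle (mgfp F) (F (mgfp F)).
  move=> A w [u [mu uF] uw].
  apply: (mF2 _ _ mu mm _ A w (uF _ _ uw)) => B v uv; by exists u.
split=> // [|u mu uF A w uw]; last by exists u => //; split=> //; rewrite uF => B.
apply/funext=> A; apply/seteqP; split=> [w Fw|]; last exact: post.
by exists (F (mgfp F)) => //; split; [exact: mF1 | apply: mF2 => //; exact: mF1].
Qed.

End Fixpoints.

Record nbhd_struct (At Gm : Type) := NbhdStruct {
  world :> Type;
  valuation : At -> set world;
  eff : Gm -> set world -> set world;
  eff_monotone : forall a, monotone (eff a)
}.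

Arguments valuation {At Gm} n P.
Arguments eff {At Gm} n a A.

Definition var := nat.

Definition upd (T : Type) (I : var -> T) (x : var) (u : T) : var -> T :=
  fun y => if y == x then u else I y.

Section Logics.
Variables At Gm : Type.

Inductive gl_form : Type :=
| GAtom (P : At)
| GNeg (phi : gl_form)
| GOr (phi psi : gl_form)
| GDia (alpha : gl_game) (phi : gl_form)
with gl_game : Type :=
| GGame (a : Gm)
| GTest (phi : gl_form)
| GChoice (alpha beta : gl_game)
| GSeq (alpha beta : gl_game)
| GStar (alpha : gl_game)
| GDual (alpha : gl_game).

Fixpoint gl_truth (N : nbhd_struct At Gm) (phi : gl_form) : set N :=
  match phi with
  | GAtom P => valuation N P
  | GNeg phi => ~` gl_truth phi
  | GOr phi psi => gl_truth phi `|` gl_truth psi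
  | GDia alpha phi => gl_eff alpha (gl_truth phi)
  end
with gl_eff (N : nbhd_struct At Gm) (alpha : gl_game) : set N -> set N :=
  match alpha with
  | GGame a => eff N a
  | GTest phi => fun A => gl_truth phi `&` A
  | GChoice alpha beta => fun A => gl_eff alpha A `|` gl_eff beta A
  | GSeq alpha beta => fun A => gl_eff alpha (gl_eff beta A)
  | GStar alpha => fun A => lfp (fun B => A `|` gl_eff alpha B)
  | GDual alpha => dual (gl_eff alpha)
  end.

Inductive flc : Type :=
| FId
| FAtom (P : At)
| FNAtom (P : At)
| FVar (x : var)
| FOr (phi psi : flc)
| FAnd (phi psi : flc)
| FDia (a : Gm) (phi : flc)
| FBox (a : Gm) (phi : flc)
| FMu (x : var) (phi : flc)
| FNu (x : var) (phi : flc)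
| FChop (phi psi : flc).

Fixpoint flc_sem (N : nbhd_struct At Gm) (phi : flc)
    (I : var -> set N -> set N) : set N -> set N :=
  match phi with
  | FId => fun A => A
  | FAtom P => fun=> valuation N P
  | FNAtom P => fun=> ~` valuation N P
  | FVar x => I x
  | FOr phi psi => fun A => flc_sem phi I A `|` flc_sem psi I A
  | FAnd phi psi => fun A => flc_sem phi I A `&` flc_sem psi I A
  | FDia a phi => fun A => eff N a (flc_sem phi I A)
  | FBox a phi => fun A => dual (eff N a) (flc_sem phi I A)
  | FMu x phi => mlfp (fun u => flc_sem phi (upd I x u))
  | FNu x phi => mgfp (fun u => flc_sem phi (upd I x u))
  | FChop phi psi => fun A => flc_sem phi I (flc_sem psi I A)
  end.

Fixpoint flc_free (x : var) (phi : flc) : bool :=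
  match phi with
  | FId | FAtom _ | FNAtom _ => false
  | FVar y => x == y
  | FOr phi psi | FAnd phi psi | FChop phi psi =>
      flc_free x phi || flc_free x psi
  | FDia _ phi | FBox _ phi => flc_free x phi
  | FMu y phi | FNu y phi => (x != y) && flc_free x phi
  end.

Fixpoint flc_occurs (x : var) (phi : flc) : bool :=
  match phi with
  | FId | FAtom _ | FNAtom _ => false
  | FVar y => x == y
  | FOr phi psi | FAnd phi psi | FChop phi psi =>
      flc_occurs x phi || flc_occurs x psi
  | FDia _ phi | FBox _ phi => flc_occurs x phi
  | FMu y phi | FNu y phi => (x == y) || flc_occurs x phi
  end.

Definition flc_closed (phi : flc) : Prop := forall x, ~~ flc_free x phi.

Definition FStar (x : var) (phi : flc) : flc := FMu x (FOr FId (FChop phi (FVar x))).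

(* Formulas are in negation normal form, so the negation of a star is
   available only through the dual form nu x. (id /\ phi o x). *)
Definition FDualStar (x : var) (phi : flc) : flc :=
  FNu x (FAnd FId (FChop phi (FVar x))).

(* All fixpoint subformulas are stars or dual stars.  Without dual stars the
   fragment would be nu-free, and a nu-free formula true at the origin of an
   infinite chain remains true when the chain is altered far away; so the GL
   formula ~<a^*>P would not be expressible. *)
Inductive star_only : flc -> Prop :=
| SO_id : star_only FId
| SO_atom P : star_only (FAtom P)
| SO_natom P : star_only (FNAtom P)
| SO_var x : star_only (FVar x)
| SO_or phi psi : star_only phi -> star_only psi -> star_only (FOr phi psi)
| SO_and phi psi : star_only phi -> star_only psi -> star_only (FAnd phi psi)
| SO_dia a phi : star_only phi -> star_only (FDia a phi)
| SO_box a phi : star_only phi -> star_only (FBox a phi)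
| SO_chop phi psi : star_only phi -> star_only psi -> star_only (FChop phi psi)
| SO_star x phi : star_only phi -> ~~ flc_occurs x phi -> star_only (FStar x phi)
| SO_dualstar x phi :
    star_only phi -> ~~ flc_occurs x phi -> star_only (FDualStar x phi).

(* The valuation is irrelevant on closed formulas, see flc_sem_closed. *)
Definition flc_truth (N : nbhd_struct At Gm) (phi : flc) : set N :=
  flc_sem phi (fun _ A => A) set0.

Inductive lmu : Type :=
| MAtom (P : At)
| MNAtom (P : At)
| MVar (x : var)
| MOr (phi psi : lmu)
| MAnd (phi psi : lmu)
| MDia (a : Gm) (phi : lmu)
| MBox (a : Gm) (phi : lmu)
| MMu (x : var) (phi : lmu)
| MNu (x : var) (phi : lmu).

Fixpoint lmu_sem (N : nbhd_struct At Gm) (phi : lmu) (I : var -> set N) : set N :=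
  match phi with
  | MAtom P => valuation N P
  | MNAtom P => ~` valuation N P
  | MVar x => I x
  | MOr phi psi => lmu_sem phi I `|` lmu_sem psi I
  | MAnd phi psi => lmu_sem phi I `&` lmu_sem psi I
  | MDia a phi => eff N a (lmu_sem phi I)
  | MBox a phi => dual (eff N a) (lmu_sem phi I)
  | MMu x phi => lfp (fun B => lmu_sem phi (upd I x B))
  | MNu x phi => gfp (fun B => lmu_sem phi (upd I x B))
  end.

Fixpoint lmu_free (x : var) (phi : lmu) : bool :=
  match phi with
  | MAtom _ | MNAtom _ => false
  | MVar y => x == y
  | MOr phi psi | MAnd phi psi => lmu_free x phi || lmu_free x psi
  | MDia _ phi | MBox _ phi => lmu_free x phi
  | MMu y phi | MNu y phi => (x != y) && lmu_free x phi
  end.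

Fixpoint lmu_occurs (x : var) (phi : lmu) : bool :=
  match phi with
  | MAtom _ | MNAtom _ => false
  | MVar y => x == y
  | MOr phi psi | MAnd phi psi => lmu_occurs x phi || lmu_occurs x psi
  | MDia _ phi | MBox _ phi => lmu_occurs x phi
  | MMu y phi | MNu y phi => (x == y) || lmu_occurs x phi
  end.

Definition lmu_closed (phi : lmu) : Prop := forall x, ~~ lmu_free x phi.

Inductive separable : lmu -> Prop :=
| Sep_atom P : separable (MAtom P)
| Sep_natom P : separable (MNAtom P)
| Sep_var x : separable (MVar x)
| Sep_or phi psi : separable phi -> separable psi -> separable (MOr phi psi)
| Sep_and phi psi : separable phi -> separable psi -> separable (MAnd phi psi)
| Sep_dia a phi : separable phi -> separable (MDia a phi)
| Sep_box a phi : separable phi -> separable (MBox a phi)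
| Sep_mu x psi rho : separable psi -> separable rho ->
    ~~ lmu_occurs x rho -> (forall y, lmu_free y psi -> y = x) ->
    separable (MMu x (MOr psi rho))
| Sep_nu x psi rho : separable psi -> separable rho ->
    ~~ lmu_occurs x rho -> (forall y, lmu_free y psi -> y = x) ->
    separable (MNu x (MAnd psi rho)).

(* The valuation is irrelevant on closed formulas, see lmu_sem_closed. *)
Definition lmu_truth (N : nbhd_struct At Gm) (phi : lmu) : set N :=
  lmu_sem phi (fun=> set0).

Lemma flc_sem_monotone (N : nbhd_struct At Gm) (phi : flc) :
  (forall I, (forall x, monotone (I x)) -> monotone (flc_sem (N := N) phi I)) /\
  (forall I J, (forall x, monotone (I x)) -> (forall x, monotone (J x)) ->
     (forall x, fle (I x) (J x)) ->
     fle (flc_sem (N := N) phi I) (flc_sem phi J)).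
Proof.
have mupd (I : var -> set N -> set N) x u : (forall x, monotone (I x)) ->
    monotone u -> forall y, monotone (upd I x u y).
  by move=> mI mu y; rewrite /upd; case: eqP.
have lupd (I J : var -> set N -> set N) x u : (forall x, fle (I x) (J x)) ->
    forall y, fle (upd I x u y) (upd J x u y).
  by move=> IJ y; rewrite /upd; case: eqP => // _ A.
have em := @eff_monotone _ _ N.
elim: phi => /= [|P|P|x|p [p1 p2] q [q1 q2]|p [p1 p2] q [q1 q2]
  |a p [p1 p2]|a p [p1 p2]|x p [p1 p2]|x p [p1 p2]|p [p1 p2] q [q1 q2]].
- by split=> [I _ A B|I J _ _ _ A].
- by split=> [I _ A B _ w|I J _ _ _ A w].
- by split=> [I _ A B _ w|I J _ _ _ A w].
- by split=> [I mI|I J _ _ IJ]; [exact: mI|exact: IJ].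
- split=> [I mI A B AB|I J mI mJ IJ A]; apply: setUSS;
    solve [exact: p1|exact: q1|exact: (p2 I J)|exact: (q2 I J)].
- split=> [I mI A B AB|I J mI mJ IJ A]; apply: setISS;
    solve [exact: p1|exact: q1|exact: (p2 I J)|exact: (q2 I J)].
- split=> [I mI A B AB|I J mI mJ IJ A]; apply: em;
    solve [exact: p1|exact: (p2 I J)].
- split=> [I mI A B AB|I J mI mJ IJ A]; apply: (dual_monotone (em a));
    solve [exact: p1|exact: (p2 I J)].
- split=> [I mI|I J mI mJ IJ A w Iw u [mu uF]]; first exact: mlfp_monotone.
  apply: Iw; split=> // B v pv; apply: uF.
  by apply: p2 pv; [exact: mupd|exact: mupd|exact: lupd].
- split=> [I mI|I J mI mJ IJ A w [u [mu uF] uw]]; first exact: mgfp_monotone.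
  exists u => //; split=> // B v uv.
  by apply: p2 (uF _ _ uv); [exact: mupd|exact: mupd|exact: lupd].
- split=> [I mI A B AB|I J mI mJ IJ A w pw]; first by apply: p1 => //; exact: q1.
  apply: (p2 I J) => //; apply: p1 pw => //; exact: q2.
Qed.

Lemma lmu_sem_monotone (N : nbhd_struct At Gm) (phi : lmu) (I J : var -> set N) :
  (forall x, I x `<=` J x) -> lmu_sem phi I `<=` lmu_sem phi J.
Proof.
have lupd (K L : var -> set N) x B : (forall x, K x `<=` L x) ->
    forall y, upd K x B y `<=` upd L x B y.
  by move=> KL y; rewrite /upd; case: eqP => // _ w.
have em := @eff_monotone _ _ N.
elim: phi I J => //= [P|P|p IHp q IHq|p IHp q IHq|a p IHp|a p IHp
  |x p IHp|x p IHp] I J IJ.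
- by move=> w.
- by move=> w.
- by apply: setUSS; [exact: IHp|exact: IHq].
- by apply: setISS; [exact: IHp|exact: IHq].
- by apply: em; exact: IHp.
- by apply: (dual_monotone (em a)); exact: IHp.
- move=> w Iw B pB; apply: Iw; apply: subset_trans pB; apply: IHp; exact: lupd.
- move=> w [B pB Bw]; exists B => //; apply: (subset_trans pB); apply: IHp; exact: lupd.
Qed.

Lemma flc_sem_free (N : nbhd_struct At Gm) (phi : flc)
    (I J : var -> set N -> set N) :
  (forall x, flc_free x phi -> I x = J x) -> flc_sem phi I = flc_sem phi J.
Proof.
elim: phi I J => //=
  [x|p IHp q IHq|p IHp q IHq|a p IHp|a p IHp|x p IHp|x p IHp|p IHp q IHq] I J IJ.
- exact: IJ.
- rewrite (IHp I J) ?(IHq I J) // => x fx; apply: IJ; by rewrite fx ?orbT.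
- rewrite (IHp I J) ?(IHq I J) // => x fx; apply: IJ; by rewrite fx ?orbT.
- by rewrite (IHp I J).
- by rewrite (IHp I J).
- congr mlfp; apply/funext=> u; apply: IHp => y fy; rewrite /upd.
  by case: eqVneq => // yx; apply: IJ; rewrite yx.
- congr mgfp; apply/funext=> u; apply: IHp => y fy; rewrite /upd.
  by case: eqVneq => // yx; apply: IJ; rewrite yx.
- rewrite (IHp I J) ?(IHq I J) // => x fx; apply: IJ; by rewrite fx ?orbT.
Qed.

Lemma flc_sem_closed (N : nbhd_struct At Gm) (phi : flc)
    (I : var -> set N -> set N) :
  flc_closed phi -> flc_sem phi I set0 = flc_truth (N := N) phi.
Proof.
move=> cl; rewrite /flc_truth (@flc_sem_free _ _ I (fun _ A => A)) // => x.
by rewrite (negPf (cl x)).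
Qed.

Lemma lmu_sem_free (N : nbhd_struct At Gm) (phi : lmu) (I J : var -> set N) :
  (forall x, lmu_free x phi -> I x = J x) -> lmu_sem phi I = lmu_sem phi J.
Proof.
elim: phi I J => //=
  [x|p IHp q IHq|p IHp q IHq|a p IHp|a p IHp|x p IHp|x p IHp] I J IJ.
- exact: IJ.
- rewrite (IHp I J) ?(IHq I J) // => x fx; apply: IJ; by rewrite fx ?orbT.
- rewrite (IHp I J) ?(IHq I J) // => x fx; apply: IJ; by rewrite fx ?orbT.
- by rewrite (IHp I J).
- by rewrite (IHp I J).
- congr lfp; apply/funext=> u; apply: IHp => y fy; rewrite /upd.
  by case: eqVneq => // yx; apply: IJ; rewrite yx.
- congr gfp; apply/funext=> u; apply: IHp => y fy; rewrite /upd.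
  by case: eqVneq => // yx; apply: IJ; rewrite yx.
Qed.

Lemma lmu_sem_closed (N : nbhd_struct At Gm) (phi : lmu) (I : var -> set N) :
  lmu_closed phi -> lmu_sem phi I = lmu_truth (N := N) phi.
Proof.
by move=> cl; apply: lmu_sem_free => x; rewrite (negPf (cl x)).
Qed.

End Logics.

Arguments gl_truth {At Gm} N phi.
Arguments flc_truth {At Gm} N phi.
Arguments lmu_truth {At Gm} N phi.

Record logic (At Gm : Type) := Logic {
  formula : Type;
  wff : formula -> Prop;
  truth : forall N : nbhd_struct At Gm, formula -> set N
}.

Arguments truth {At Gm} l N phi.

Definition GL (At Gm : Type) : logic At Gm :=
  @Logic At Gm (gl_form At Gm) (fun=> True) gl_truth.

Definition Lstar (At Gm : Type) : logic At Gm :=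
  @Logic At Gm (flc At Gm) (fun phi => flc_closed phi /\ star_only phi)
    flc_truth.

Definition Lsep (At Gm : Type) : logic At Gm :=
  @Logic At Gm (lmu At Gm) (fun phi => lmu_closed phi /\ separable phi)
    lmu_truth.

Definition expressible_in (At Gm : Type) (L1 L2 : logic At Gm) : Prop :=
  forall phi : formula L1, wff phi ->
    exists2 psi : formula L2, wff psi &
      forall N : nbhd_struct At Gm, truth L1 N phi = truth L2 N psi.

Definition equiexpressive (At Gm : Type) (L1 L2 : logic At Gm) : Prop :=
  expressible_in L1 L2 /\ expressible_in L2 L1.

(* Main.v *)
(* All three logics define the same families of operators on the powersets of
   structures: the least class containing the identity, the constants V(P) and
   W \ V(P), the atomic games and their duals, and closed under union,
   intersection, composition, star and dual star.  Pushing duals inwards shows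
   that every GL game and its dual lie in any such class, and each of the three
   classes of definable operators is of this kind; in L_s an operator is
   represented as a map sending a separable formula rho to a separable formula
   without further free variables.  Conversely a closed star-only formula is
   built from these operations, and a separable formula with at most one free
   variable x denotes a game operator applied to the value of x, because the
   side conditions on mu x. (psi \/ rho) make it alpha^* applied to the value
   of rho, where alpha is the game given by psi. *)
From mathcomp Require Import all_boot.
From mathcomp Require Import boolp classical_sets.
Require Import Defs.

Set Implicit Arguments.
Unset Strict Implicit.
Unset Printing Implicit Defensive.

Local Open Scope classical_set_scope.

(** * Star and dual star as operators on a powerset *)

Section StarOperators.
Variable W : Type.
Implicit Types (f : set W -> set W) (A : set W).

Definition star f A : set W := lfp (fun B => A `|` f B).
Definition dual_star f A : set W := gfp (fun B => A `&` f B).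

(** Complementation exchanges the pre-fixpoints of [f] with the post-fixpoints of [dual f]. *)
Lemma setC_lfp f : ~` lfp f = gfp (dual f).
Proof.
apply/seteqP; split=> w.
  move=> nw; apply: contrapT => ng; apply: nw => B fB.
  apply: contrapT => nBw; apply: ng; exists (~` B) => //=.
  by rewrite /dual setCK; apply: subsetC.
move=> [B Bf Bw] /(_ (~` B)); apply => //=.
by move=> v fv Bv; apply: (Bf v Bv).
Qed.

Lemma dualK f : dual (dual f) = f.
Proof. by apply/funext=> A; rewrite /dual !setCK. Qed.

Lemma dual_of_star f : dual (star f) = dual_star (dual f).
Proof.
apply/funext=> A; rewrite /dual /star setC_lfp; congr gfp.
by apply/funext=> B; rewrite /dual setCU setCK.
Qed.

(** The fixpoint over monotone maps is computed argumentwise: [star f] is itself a monotone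
    candidate, and every candidate [u] makes [u A] a pre-fixpoint of the set map that defines
    [star f A]. *)
Lemma mlfp_star f : monotone f -> mlfp (fun u A => A `|` f (u A)) = star f.
Proof.
move=> mf.
have ms A : monotone (fun B => A `|` f B) by move=> B C BC; apply: setUS; apply: mf.
apply/funext=> A; apply/seteqP; split=> w.
  apply; split=> [B C BC v Bv D fD|B].
    by apply: Bv; apply: subset_trans fD; apply: setSU.
  by have [-> _] := lfp_least_fixpoint (ms B).
by move=> sw u [mu uF]; apply: sw; apply: uF.
Qed.

Lemma mgfp_dual_star f : monotone f ->
  mgfp (fun u A => A `&` f (u A)) = dual_star f.
Proof.
move=> mf.
have ms A : monotone (fun B => A `&` f B) by move=> B C BC; apply: setIS; apply: mf.
apply/funext=> A; apply/seteqP; split=> w.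
  by move=> [u [mu uF] uw]; exists (u A) => //; apply: uF.
move=> sw; exists (dual_star f) => //; split=> [B C BC v [D fD Dv]|B].
  by exists D => //; apply: (subset_trans fD); apply: setSI.
by have [e _] := gfp_greatest_fixpoint (ms B); rewrite {1}/dual_star -e.
Qed.

End StarOperators.

Scheme gl_form_game_ind := Induction for gl_form Sort Prop
  with gl_game_form_ind := Induction for gl_game Sort Prop.
Combined Scheme gl_mutind from gl_form_game_ind, gl_game_form_ind.

Lemma upd_same (T : Type) (I : var -> T) x u : upd I x u x = u.
Proof. by rewrite /upd eqxx. Qed.

(** * Operators uniform in the structure, and classes of them *)

Section Operators.
Variables At Gm : Type.

Definition operator := forall N : nbhd_struct At Gm, set N -> set N.

Implicit Types (C : operator -> Prop) (F G : operator).

Record operator_class C : Prop := OperatorClass {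
  class_id : C (fun _ A => A);
  class_atom P : C (fun N _ => valuation N P);
  class_natom P : C (fun N _ => ~` valuation N P);
  class_eff a : C (fun N => eff N a);
  class_dual_eff a : C (fun N => dual (eff N a));
  class_or F G : C F -> C G -> C (fun N A => F N A `|` G N A);
  class_and F G : C F -> C G -> C (fun N A => F N A `&` G N A);
  class_comp F G : C F -> C G -> C (fun N A => F N (G N A));
  class_star F : C F -> C (fun N => star (F N));
  class_dual_star F : C F -> C (fun N => dual_star (F N))
}.

Lemma operator_ext F G : (forall N A, F N A = G N A) -> F = G.
Proof. by move=> FG; apply: functional_extensionality_dep => N; apply/funext. Qed.

(** A class need not be closed under duals, so the induction carries each formula with its
    complement, both as constant operators, and each game with its dual; De Morgan laws settle the
    cases. *)
Lemma class_gl C : operator_class C ->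
  (forall phi, C (fun N _ => gl_truth N phi) /\
               C (fun N _ => ~` gl_truth N phi)) /\
  (forall alpha, C (fun N => gl_eff (N := N) alpha) /\
                 C (fun N => dual (gl_eff (N := N) alpha))).
Proof.
move=> cC; have ext F G : C F -> (forall N A, F N A = G N A) -> C G.
  by move=> CF /operator_ext <-.
apply: gl_mutind => /=.
- by move=> P; split; [exact: class_atom|exact: class_natom].
- move=> phi [p n]; split=> //; apply: (ext _ _ p) => N A; by rewrite setCK.
- move=> phi [p n] psi [p' n']; split; first exact: class_or.
  by apply: (ext _ _ (class_and cC n n')) => N A; rewrite setCU.
- move=> alpha [a d] phi [p n]; split; first exact: (class_comp cC a p).
  by apply: (ext _ _ (class_comp cC d n)) => N A; rewrite /dual setCK.
- by move=> a; split; [exact: class_eff|exact: class_dual_eff].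
- move=> phi [p n]; split; first exact: (class_and cC p (class_id cC)).
  by apply: (ext _ _ (class_or cC n (class_id cC))) => N A;
    rewrite /dual setCI setCK.
- move=> alpha [a d] beta [a' d']; split; first exact: class_or.
  by apply: (ext _ _ (class_and cC d d')) => N A; rewrite /dual setCU.
- move=> alpha [a d] beta [a' d']; split; first exact: (class_comp cC a a').
  by apply: (ext _ _ (class_comp cC d d')) => N A; rewrite /dual setCK.
- move=> alpha [a d]; split; first exact: (class_star cC a).
  apply: (ext _ _ (class_dual_star cC d)) => N A.
  by rewrite -dual_of_star.
- by move=> alpha [a d]; split=> //; apply: (ext _ _ a) => N A; rewrite dualK.
Qed.

(** * Operators definable in each logic; the class of game operators *)

Definition gl_definable F : Prop :=
  exists alpha, forall N A, gl_eff (N := N) alpha A = F N A.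

Definition flc_definable F : Prop :=
  exists phi, [/\ flc_closed phi, star_only phi &
    forall N I, flc_sem (N := N) phi I = F N].

(** The bound on free variables lets fixpoints be formed: from [MVar x] it yields a formula in which
    at most [x] is free. *)
Definition lmu_definable F : Prop :=
  forall rho, separable rho -> exists psi, [/\ separable psi,
    forall y, lmu_free y psi -> lmu_free y rho &
    forall N I, lmu_sem (N := N) psi I = F N (lmu_sem rho I)].

Lemma gl_definable_dual F :
  gl_definable F -> gl_definable (fun N => dual (F N)).
Proof. by move=> [a aF]; exists (GDual a) => N A /=; rewrite /dual aF. Qed.

Lemma gl_definable_const (P0 : At) phi :
  gl_definable (fun N _ => gl_truth N phi).
Proof.
pose bot := GNeg (GOr (GAtom Gm P0) (GNeg (GAtom Gm P0))).
(* The dual of the test of falsum sends every set to the whole space, so the argument is discarded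
   before [phi] is tested. *)
exists (GSeq (GTest phi) (GDual (GTest bot))) => N A /=.
by rewrite /dual setUv setCT set0I setC0 setIT.
Qed.

Lemma gl_definable_class (P0 : At) : operator_class gl_definable.
Proof.
(* Union and star come first, since intersection and dual star are obtained from them by
   dualising. *)
have or F G : gl_definable F -> gl_definable G ->
    gl_definable (fun N A => F N A `|` G N A).
  by move=> [a aF] [b bG]; exists (GChoice a b) => N A /=; rewrite aF bG.
have st F : gl_definable F -> gl_definable (fun N => star (F N)).
  move=> [a aF]; exists (GStar a) => N A /=; congr lfp.
  by apply/funext=> B; rewrite aF.
split=> //.
- exists (GTest (GOr (GAtom _ P0) (GNeg (GAtom _ P0)))) => N A /=.
  by rewrite setUv setTI.
- by move=> P; apply: (gl_definable_const P0 (GAtom _ P)).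
- by move=> P; apply: (gl_definable_const P0 (GNeg (GAtom _ P))).
- by move=> a; exists (GGame _ a).
- by move=> a; exists (GDual (GGame _ a)).
- move=> F G dF dG.
  have [a aE] := gl_definable_dual
    (or _ _ (gl_definable_dual dF) (gl_definable_dual dG)).
  by exists a => N A; rewrite aE /dual setCU !setCK.
- by move=> F G [a aF] [b bG]; exists (GSeq a b) => N A /=; rewrite aF bG.
- move=> F dF.
  have [a aE] := gl_definable_dual (st _ (gl_definable_dual dF)).
  by exists a => N A; rewrite aE dual_of_star dualK.
Qed.

(** * Free, occurring and fresh variables *)

Lemma flc_free_occurs x (phi : flc At Gm) : flc_free x phi -> flc_occurs x phi.
Proof.
elim: phi => //= [p IHp q IHq|p IHp q IHq|y p IHp|y p IHp|p IHp q IHq].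
- by move=> /orP[/IHp|/IHq] ->; rewrite ?orbT.
- by move=> /orP[/IHp|/IHq] ->; rewrite ?orbT.
- by move=> /andP[_ /IHp ->]; rewrite orbT.
- by move=> /andP[_ /IHp ->]; rewrite orbT.
- by move=> /orP[/IHp|/IHq] ->; rewrite ?orbT.
Qed.

Lemma lmu_free_occurs x (phi : lmu At Gm) : lmu_free x phi -> lmu_occurs x phi.
Proof.
elim: phi => //= [p IHp q IHq|p IHp q IHq|y p IHp|y p IHp].
- by move=> /orP[/IHp|/IHq] ->; rewrite ?orbT.
- by move=> /orP[/IHp|/IHq] ->; rewrite ?orbT.
- by move=> /andP[_ /IHp ->]; rewrite orbT.
- by move=> /andP[_ /IHp ->]; rewrite orbT.
Qed.

Lemma flc_fresh (phi : flc At Gm) : exists x, ~~ flc_occurs x phi.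
Proof.
(* Variables are natural numbers, so a strict bound on those that occur is itself fresh. *)
suff [n nP] : exists n, forall x, flc_occurs x phi -> x < n.
  by exists n; apply/negP => /nP; rewrite ltnn.
have bin (p q : pred nat) : (exists n, forall x, p x -> x < n) ->
    (exists n, forall x, q x -> x < n) ->
    exists n, forall x, p x || q x -> x < n.
  move=> [m mP] [n nP]; exists (maxn m n) => x; rewrite leq_max.
  by move=> /orP[/mP|/nP] ->; rewrite ?orbT.
have one y : exists n, forall x, x == y -> x < n by exists y.+1 => x /eqP ->.
elim: phi => //=; do ?by exists 0.
all: by move=> *; apply: bin.
Qed.

Lemma lmu_fresh (phi : lmu At Gm) : exists x, ~~ lmu_occurs x phi.
Proof.
suff [n nP] : exists n, forall x, lmu_occurs x phi -> x < n.
  by exists n; apply/negP => /nP; rewrite ltnn.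
have bin (p q : pred nat) : (exists n, forall x, p x -> x < n) ->
    (exists n, forall x, q x -> x < n) ->
    exists n, forall x, p x || q x -> x < n.
  move=> [m mP] [n nP]; exists (maxn m n) => x; rewrite leq_max.
  by move=> /orP[/mP|/nP] ->; rewrite ?orbT.
have one y : exists n, forall x, x == y -> x < n by exists y.+1 => x /eqP ->.
elim: phi => //=; do ?by exists 0.
all: by move=> *; apply: bin.
Qed.

(** * The class of operators definable in the star calculus *)

Lemma flc_sem_closed_monotone (N : nbhd_struct At Gm) phi I :
  flc_closed phi -> monotone (flc_sem (N := N) phi I).
Proof.
(* [I] may fail to be monotone; closedness allows replacing it by the identity valuation. *)
move=> cl; rewrite (@flc_sem_free _ _ _ _ I (fun _ A => A)); last first.
  by move=> x; rewrite (negPf (cl x)).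
by apply: (flc_sem_monotone N phi).1 => _ A B.
Qed.

Lemma flc_sem_star (N : nbhd_struct At Gm) x phi I : flc_closed phi ->
  flc_sem (N := N) (FStar x phi) I = star (flc_sem phi I).
Proof.
move=> cl; rewrite -mlfp_star; last exact: flc_sem_closed_monotone.
rewrite /=; congr mlfp; apply/funext=> u; apply/funext=> A.
rewrite upd_same (@flc_sem_free _ _ _ _ (upd I x u) I) // => y.
by rewrite (negPf (cl y)).
Qed.

Lemma flc_sem_dual_star (N : nbhd_struct At Gm) x phi I : flc_closed phi ->
  flc_sem (N := N) (FDualStar x phi) I = dual_star (flc_sem phi I).
Proof.
move=> cl; rewrite -mgfp_dual_star; last exact: flc_sem_closed_monotone.
rewrite /=; congr mgfp; apply/funext=> u; apply/funext=> A.
rewrite upd_same (@flc_sem_free _ _ _ _ (upd I x u) I) // => y.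
by rewrite (negPf (cl y)).
Qed.

Lemma flc_definable_class : operator_class flc_definable.
Proof.
split.
- by exists (FId _ _); split=> //; constructor.
- by move=> P; exists (FAtom _ P); split=> //; constructor.
- by move=> P; exists (FNAtom _ P); split=> //; constructor.
- by move=> a; exists (FDia a (FId _ _)); split=> //; do 2!constructor.
- by move=> a; exists (FBox a (FId _ _)); split=> //; do 2!constructor.
- move=> F G [p [cp sp pF]] [q [cq sq qG]]; exists (FOr p q); split.
  + by move=> x /=; rewrite negb_or cp cq.
  + exact: SO_or.
  + by move=> N I /=; rewrite pF qG.
- move=> F G [p [cp sp pF]] [q [cq sq qG]]; exists (FAnd p q); split.
  + by move=> x /=; rewrite negb_or cp cq.
  + exact: SO_and.
  + by move=> N I /=; rewrite pF qG.
- move=> F G [p [cp sp pF]] [q [cq sq qG]]; exists (FChop p q); split.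
  + by move=> x /=; rewrite negb_or cp cq.
  + exact: SO_chop.
  + by move=> N I /=; rewrite pF qG.
- move=> F [p [cp sp pF]]; have [x xp] := flc_fresh p.
  exists (FStar x p); split.
  + by move=> y /=; rewrite (negPf (cp y)) /= andNb.
  + exact: SO_star.
  + by move=> N I; rewrite flc_sem_star // pF.
- move=> F [p [cp sp pF]]; have [x xp] := flc_fresh p.
  exists (FDualStar x p); split.
  + by move=> y /=; rewrite (negPf (cp y)) /= andNb.
  + exact: SO_dualstar.
  + by move=> N I; rewrite flc_sem_dual_star // pF.
Qed.

(** * The class of operators definable by separable formulas *)

Lemma lmu_sem_upd_fresh (N : nbhd_struct At Gm) x (rho : lmu At Gm) I B :
  ~~ lmu_occurs x rho -> lmu_sem (N := N) rho (upd I x B) = lmu_sem rho I.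
Proof.
move=> xr; apply: lmu_sem_free => y; rewrite /upd; case: eqP => // -> fx.
by rewrite lmu_free_occurs in xr.
Qed.

Lemma lmu_definable_class : operator_class lmu_definable.
Proof.
split.
- by move=> rho sr; exists rho.
- by move=> P rho sr; exists (MAtom _ P); split=> //; constructor.
- by move=> P rho sr; exists (MNAtom _ P); split=> //; constructor.
- by move=> a rho sr; exists (MDia a rho); split=> //; constructor.
- by move=> a rho sr; exists (MBox a rho); split=> //; constructor.
- move=> F G dF dG rho sr.
  have [p [sp fp pF]] := dF rho sr; have [q [sq fq qG]] := dG rho sr.
  exists (MOr p q); split; first exact: Sep_or.
  + by move=> x /= /orP[/fp|/fq].
  + by move=> N I /=; rewrite pF qG.
- move=> F G dF dG rho sr.
  have [p [sp fp pF]] := dF rho sr; have [q [sq fq qG]] := dG rho sr.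
  exists (MAnd p q); split; first exact: Sep_and.
  + by move=> x /= /orP[/fp|/fq].
  + by move=> N I /=; rewrite pF qG.
- move=> F G dF dG rho sr.
  have [q [sq fq qG]] := dG rho sr; have [p [sp fp pF]] := dF q sq.
  exists p; split=> // [x /fp /fq //|N I]; by rewrite pF qG.
(* The fixpoint body is [F] applied to a variable fresh for [rho]; hence the side conditions of
   separability hold and [rho] keeps its value under the binder. *)
- move=> F dF rho sr; have [x xr] := lmu_fresh rho.
  have [p [sp fp pF]] := dF (MVar _ _ x) (Sep_var _ _ x).
  exists (MMu x (MOr p rho)); split.
  + by apply: Sep_mu => // y /fp /eqP.
  + by move=> y /= /andP[/negPf yx /orP[/fp|//]]; rewrite /= yx.
  + move=> N I /=; congr lfp; apply/funext=> B.
    by rewrite pF /= upd_same lmu_sem_upd_fresh // setUC.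
- move=> F dF rho sr; have [x xr] := lmu_fresh rho.
  have [p [sp fp pF]] := dF (MVar _ _ x) (Sep_var _ _ x).
  exists (MNu x (MAnd p rho)); split.
  + by apply: Sep_nu => // y /fp /eqP.
  + by move=> y /= /andP[/negPf yx /orP[/fp|//]]; rewrite /= yx.
  + move=> N I /=; congr gfp; apply/funext=> B.
    by rewrite pF /= upd_same lmu_sem_upd_fresh // setIC.
Qed.

(** * Formulas of the two fixpoint logics as members of any class *)

Lemma class_flc C phi : operator_class C -> star_only phi -> flc_closed phi ->
  C (fun N => flc_sem (N := N) phi (fun _ A => A)).
Proof.
move=> cC; have bin (p q : flc At Gm) :
    (forall x, ~~ (flc_free x p || flc_free x q)) ->
    flc_closed p /\ flc_closed q.
  by move=> pq; split=> x; have := pq x; rewrite negb_or => /andP[].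
(* The induction stays within closed formulas: the bound variable of a star does not occur in its
   body, so binding it hides no free variable. *)
have body x (p : flc At Gm) : ~~ flc_occurs x p ->
    (forall y, ~~ ((y != x) && (flc_free y p || (y == x)))) -> flc_closed p.
  move=> xp cl y; apply/negP => fy; have := cl y; rewrite fy andbT negbK.
  by move=> /eqP yx; move: xp; rewrite -yx flc_free_occurs.
elim=> {phi} /=.
- by move=> _; apply: class_id.
- by move=> P _; apply: class_atom.
- by move=> P _; apply: class_natom.
- by move=> x /(_ x) /=; rewrite eqxx.
- by move=> p q _ IHp _ IHq /bin[/IHp ? /IHq ?]; apply: class_or.
- by move=> p q _ IHp _ IHq /bin[/IHp ? /IHq ?]; apply: class_and.
- move=> a p _ IHp /IHp pC; exact: (class_comp cC (class_eff cC a) pC).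
- move=> a p _ IHp /IHp pC; exact: (class_comp cC (class_dual_eff cC a) pC).
- by move=> p q _ IHp _ IHq /bin[/IHp pC /IHq qC]; apply: (class_comp cC pC qC).
- move=> x p _ IHp xp /(body _ _ xp) cp.
  have := class_star cC (IHp cp); congr C; apply: operator_ext => N A.
  by rewrite -(flc_sem_star x).
- move=> x p _ IHp xp /(body _ _ xp) cp.
  have := class_dual_star cC (IHp cp); congr C; apply: operator_ext => N A.
  by rewrite -(flc_sem_dual_star x).
Qed.

(** Allowing one free variable carries the induction under binders: in a fixpoint over [z], the
    recursive part is treated with [z] as its variable and the side part with [x], and the star of
    the first operator is composed with the second. *)
Lemma class_lmu C phi : operator_class C -> separable phi ->
  forall x, (forall y, lmu_free y phi -> y = x) ->
  exists2 F, C F & forall N I, lmu_sem (N := N) phi I = F N (I x).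
Proof.
move=> cC.
have bin x (p q : lmu At Gm) :
    (forall y, lmu_free y p || lmu_free y q -> y = x) ->
    (forall y, lmu_free y p -> y = x) /\ (forall y, lmu_free y q -> y = x).
  by move=> pq; split=> y fy; apply: pq; rewrite fy ?orbT.
have body z x (p q : lmu At Gm) : ~~ lmu_occurs z q ->
    (forall y, (y != z) && (lmu_free y p || lmu_free y q) -> y = x) ->
    forall y, lmu_free y q -> y = x.
  move=> zq cl y fy; apply: cl; rewrite fy orbT andbT.
  by apply: contraNneq zq => <-; apply: lmu_free_occurs.
elim=> {phi} /=.
- by move=> P x _; exists (fun N _ => valuation N P) => //; apply: class_atom.
- by move=> P x _; exists (fun N _ => ~` valuation N P) => //;
    apply: class_natom.
- move=> y x /(_ y (eqxx y)) ->; exists (fun _ A => A) => //.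
  exact: class_id.
- move=> p q _ IHp _ IHq x /bin[/IHp[F CF pF] /IHq[G CG qG]].
  exists (fun N A => F N A `|` G N A); first exact: class_or.
  by move=> N I; rewrite pF qG.
- move=> p q _ IHp _ IHq x /bin[/IHp[F CF pF] /IHq[G CG qG]].
  exists (fun N A => F N A `&` G N A); first exact: class_and.
  by move=> N I; rewrite pF qG.
- move=> a p _ IHp x /IHp[F CF pF].
  exists (fun N A => eff N a (F N A)); last by move=> N I; rewrite pF.
  exact: (class_comp cC (class_eff cC a) CF).
- move=> a p _ IHp x /IHp[F CF pF].
  exists (fun N A => dual (eff N a) (F N A)); last by move=> N I; rewrite pF.
  exact: (class_comp cC (class_dual_eff cC a) CF).
- move=> z p q _ IHp _ IHq zq fp x /(body _ _ _ _ zq)/IHq[G CG qG].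
  have [F CF pF] := IHp z fp.
  exists (fun N A => star (F N) (G N A)).
    exact: (class_comp cC (class_star cC CF) CG).
  move=> N I; congr lfp; apply/funext=> B.
  by rewrite pF upd_same lmu_sem_upd_fresh // qG setUC.
- move=> z p q _ IHp _ IHq zq fp x /(body _ _ _ _ zq)/IHq[G CG qG].
  have [F CF pF] := IHp z fp.
  exists (fun N A => dual_star (F N) (G N A)).
    exact: (class_comp cC (class_dual_star cC CF) CG).
  move=> N I; congr gfp; apply/funext=> B.
  by rewrite pF upd_same lmu_sem_upd_fresh // qG setIC.
Qed.

(** * Translations between the three logics *)

Lemma gl_definable_at_set0 (P0 : At) F : gl_definable F ->
  exists phi, forall N, F N set0 = gl_truth N phi.
Proof.
move=> [alpha aF].
exists (GDia alpha (GNeg (GOr (GAtom _ P0) (GNeg (GAtom _ P0))))) => N /=.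
by rewrite setUv setCT aF.
Qed.

Lemma gl_in_lstar : expressible_in (GL At Gm) (Lstar At Gm).
Proof.
move=> /= phi _.
have [[p [cp sp pE]] _] := (class_gl flc_definable_class).1 phi.
by exists p => // N; rewrite /flc_truth pE.
Qed.

Lemma gl_in_lsep (P0 : At) : expressible_in (GL At Gm) (Lsep At Gm).
Proof.
move=> /= phi _.
have [dphi _] := (class_gl lmu_definable_class).1 phi.
(* The operator of [phi] is constant, so it may be applied to an atom; an atom is closed, hence so
   is the result. *)
have [p [sp fp pE]] := dphi _ (Sep_atom _ P0).
exists p => [|N]; last by rewrite /lmu_truth pE.
by split=> // x; apply/negP => /fp.
Qed.

Lemma lstar_in_gl (P0 : At) : expressible_in (Lstar At Gm) (GL At Gm).
Proof.
move=> /= phi [cphi sphi].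
have [psi psiE] := gl_definable_at_set0 P0
  (class_flc (gl_definable_class P0) sphi cphi).
by exists psi.
Qed.

Lemma lsep_in_gl (P0 : At) : expressible_in (Lsep At Gm) (GL At Gm).
Proof.
move=> /= phi [cphi sphi].
(* A closed formula meets the hypothesis for any variable, here 0; [lmu_truth] gives it the empty
   set as value. *)
have [|F dF phiF] := class_lmu (gl_definable_class P0) sphi (x := 0).
  by move=> y; rewrite (negPf (cphi y)).
have [psi psiE] := gl_definable_at_set0 P0 dF.
by exists psi => // N; rewrite /lmu_truth phiF.
Qed.

Lemma expressible_in_trans (L1 L2 L3 : logic At Gm) :
  expressible_in L1 L2 -> expressible_in L2 L3 -> expressible_in L1 L3.
Proof.
move=> L12 L23 phi /L12[psi /L23[chi wchi psichi] phipsi].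
by exists chi => // N; rewrite phipsi.
Qed.

End Operators.

Theorem theorem5p7 (At Gm : Type) (At_inh : inhabited At) :
  equiexpressive (GL At Gm) (Lstar At Gm) /\
  equiexpressive (Lstar At Gm) (Lsep At Gm) /\
  equiexpressive (GL At Gm) (Lsep At Gm).
Proof.
(* An atom is what truth and falsum are written with in game logic. *)
have [P0] := At_inh.
have gs := @gl_in_lstar At Gm; have gm := @gl_in_lsep At Gm P0.
have sg := @lstar_in_gl At Gm P0; have mg := @lsep_in_gl At Gm P0.
do 2!split=> //; split.
  exact: expressible_in_trans sg gm.
exact: expressible_in_trans mg gs.
Qed.
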